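(* Let $G=(V,E)$ be a finite simple undirected graph and let $k,k'\geqslant 2$ be integers. For every clique $C\subseteq V$ of $G$ with $|C|>k'$, the ``$(y,z)$-clique'' inequality $$ k'\,z(C)\;\geqslant\;y(C)-t'\binom{k'}{2}-\binom{r'}{2}, $$ where $t'=\lfloor |C|/k'\rfloor$ and $r'=|C| \bmod k'$, is valid, i.e. it is satisfied by every feasible solution $(x,y,z)$ of the 2L-PP on $G$ with parameters $k,k'$.
   Context: Colours are the integers in $\{0,\ldots,kk'-1\}$. A feasible solution of the 2L-PP (2-level partition problem) on $G$ corresponds to an arbitrary assignment of one colour to each vertex (adjacent vertices may share a colour), encoded by binary variables as follows: for $v\in V$ and $c\in\{0,\ldots,kk'-1\}$, $x_{vc}=1$ if and only if $v$ has colour $c$; for each edge $\{u,v\}\in E$, $y_{uv}=1$ if and only if the colours of $u$ and $v$ are congruent modulo $k$, and $z_{uv}=1$ if and only if $u$ and $v$ have the same colour (otherwise these variables are $0$). A clique is a set of pairwise adjacent vertices of $G$. For a clique $C$, $y(C)=\sum_{\{u,v\}\subseteq C}y_{uv}$ and $z(C)=\sum_{\{u,v\}\subseteq C}z_{uv}$, the sums being over unordered pairs of distinct vertices of $C$. *)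

(* Defs.v *)
From mathcomp Require Import all_boot all_order all_algebra.

Set Implicit Arguments.
Unset Strict Implicit.
Unset Printing Implicit Defensive.

Import Order.TTheory GRing.Theory Num.Theory.
Local Open Scope ring_scope.

Definition clique (V : finType) (e : rel V) (C : {set V}) : Prop :=
  {in C &, forall u v : V, u != v -> e u v}.

(* The edge variables y and z are indexed by unordered pairs, i.e. by sets
   [set u; v]; only their values at the edges of the graph are constrained. *)
Definition feasible (V : finType) (e : rel V) (k k' : nat)
    (x : V -> 'I_(k * k') -> int) (y z : {set V} -> int) : Prop :=
  exists col : V -> 'I_(k * k'),
    [/\ forall v c, x v c = (col v == c)%:Z,
        forall u v, e u v -> y [set u; v] = (col u == col v %[mod k])%N%:Z
      & forall u v, e u v -> z [set u; v] = (col u == col v)%:Z].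

Definition pair_sum (V : finType) (w : {set V} -> int) (C : {set V}) : int :=
  \sum_(p : {set V} | (p \subset C) && (#|p| == 2)%N) w p.

(* Main.v *)
Require Import Defs.
From mathcomp Require Import all_boot all_order all_algebra.
From mathcomp Require Import zify ring.

(** Only the numbers of vertices of each colour matter.  Write a colour as a
    pair (residue modulo k, quotient by k).  Let n_i be the number of vertices
    of C with residue i and m_ij the number of those with quotient j, so that
    n_i is the sum over the k' values of j of the m_ij.  Counting the pairs
    inside the fibres of a map ([pair_sum_fibers]) turns y(C) into the sum of
    the binomials C(n_i, 2) and z(C) into the sum of the C(m_ij, 2).

    The right-hand constant is [packed_pairs k' #|C|], where
    [packed_pairs q n] counts the pairs inside the blocks when n points are
    cut into blocks of size q and one block of size n mod q.  Two facts
    finish the proof.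
    - Within one residue class ([bin2_sum_le]):
      C(n_i, 2) <= k' * sum_j C(m_ij, 2) + packed_pairs k' n_i.
      The sum of the C(m_ij, 2) is least when the m_ij are as equal as
      possible, and the inequality is then an equality.
    - Across classes ([packed_pairs_sum]): packed_pairs k' is superadditive,
      since merging two incomplete blocks and refilling one of them up to
      size k' never loses pairs. *)

Set Implicit Arguments.
Unset Strict Implicit.
Unset Printing Implicit Defensive.

Import Order.TTheory GRing.Theory Num.Theory.
Local Open Scope ring_scope.

Definition packed_pairs (q n : nat) : nat :=
  (n %/ q * 'C(q, 2) + 'C(n %% q, 2))%N.

(** Doubling clears the denominator of a binomial, which makes inequalities
    between binomials polynomial. *)
Lemma bin2_doubleZ (n : nat) : 2 * 'C(n, 2)%:Z = n%:Z * (n%:Z - 1).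
Proof.
case: n => [|n]; first by rewrite bin0n mulr0 mul0r.
have := mul_bin_diag n.+1 1; rewrite bin1 /= => ?; nia.
Qed.

(** By convexity C(m, 2) lies, at integers, above its secant through m = t and
    m = t + 1; doubled, this says that (m - t)(m - t - 1) >= 0. *)
Lemma bin2_secant (t m : nat) : (t * m <= 'C(m, 2) + 'C(t.+1, 2))%N.
Proof.
have := bin2_doubleZ m; have := bin2_doubleZ t.+1.
by case: (leqP m t) => ?; nia.
Qed.

(** The secant bound is summed with t = n %/ #|B|, so that the secant passes
    through the two values t and t + 1 taken by the most equal distribution
    of n, for which nothing is lost. *)
Lemma bin2_sum_le (B : finType) (m : B -> nat) :
  ('C(\sum_j m j, 2)
     <= #|B| * \sum_j 'C(m j, 2) + packed_pairs #|B| (\sum_j m j))%N.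
Proof.
set n := (\sum_j m j)%N; set q := #|B|; pose t := (n %/ q)%N.
have sum_secant : (t * n <= \sum_j 'C(m j, 2) + q * 'C(t.+1, 2))%N.
  rewrite big_distrr /= -sum_nat_const -big_split /=.
  by apply: leq_sum => j _; apply: bin2_secant.
have n_divq : n = (t * q + n %% q)%N by apply: divn_eq.
rewrite /packed_pairs -/t; move: (n %% q)%N n_divq => r n_divq.
have bin_n : ('C(n, 2) + q * (q * 'C(t.+1, 2))
              = q * (t * n) + (t * 'C(q, 2) + 'C(r, 2)))%N.
  apply/eqP; rewrite -eqz_nat !PoszD !PoszM.
  apply/eqP/(@mulfI _ 2) => //.
  have -> : 2 * ('C(n, 2)%:Z + q%:Z * (q%:Z * 'C(t.+1, 2)%:Z))
    = 2 * 'C(n, 2)%:Z + q%:Z * (q%:Z * (2 * 'C(t.+1, 2)%:Z)) by ring.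
  have -> : 2 * (q%:Z * (t%:Z * n%:Z) + (t%:Z * 'C(q, 2)%:Z + 'C(r, 2)%:Z))
    = 2 * (q%:Z * (t%:Z * n%:Z))
      + (t%:Z * (2 * 'C(q, 2)%:Z) + 2 * 'C(r, 2)%:Z) by ring.
  by rewrite !bin2_doubleZ n_divq -addn1 !PoszD !PoszM; ring.
rewrite -(leq_add2r (q * (q * 'C(t.+1, 2)))) bin_n addnAC leq_add2r.
by rewrite -mulnDr leq_mul2l sum_secant orbT.
Qed.

(** If the two remainders r, s fit into one block, merging them adds r * s
    pairs; otherwise they become a full block and a remainder r + s - q, and
    the gain is (q - r) * (q - s). *)
Lemma packed_pairs_superadditive (q a b : nat) : (0 < q)%N ->
  (packed_pairs q a + packed_pairs q b <= packed_pairs q (a + b))%N.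
Proof.
move=> q_gt0; rewrite /packed_pairs divnD // modnD //.
move: (a %/ q)%N (b %/ q)%N (ltn_pmod a q_gt0) (ltn_pmod b q_gt0) => ta tb.
move: (a %% q)%N (b %% q)%N => r s r_lt s_lt.
have := bin2_doubleZ r; have := bin2_doubleZ s.
case: (leqP q (r + s)) => [q_le | q_gt] /= Es Er.
- have Eq := bin2_doubleZ q.
  have := bin2_doubleZ (r + s - q); rewrite mul1n => Eu.
  have : 'C(r, 2)%:Z + 'C(s, 2)%:Z <= 'C(q, 2)%:Z + 'C(r + s - q, 2)%:Z.
    by rewrite -subzn // PoszD in Eu; nia.
  nia.
- rewrite mul0n subn0; have := bin2_doubleZ (r + s); rewrite PoszD => Eu.
  have : 'C(r, 2)%:Z + 'C(s, 2)%:Z <= 'C(r + s, 2)%:Z by nia.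
  nia.
Qed.

Lemma packed_pairs_sum (I : finType) (q : nat) (n : I -> nat) : (0 < q)%N ->
  (\sum_i packed_pairs q (n i) <= packed_pairs q (\sum_i n i))%N.
Proof.
move=> q_gt0; elim/big_rec2: _ => // i a b _ le_ba.
by apply: leq_trans (packed_pairs_superadditive _ _ q_gt0); rewrite leq_add2l.
Qed.

Lemma card_fibers (V T : finType) (f : V -> T) (C : {set V}) :
  #|C| = (\sum_i #|[set u in C | f u == i]|)%N.
Proof.
rewrite -sum1_card (partition_big f xpredT) //=.
by apply: eq_bigr => i _; rewrite -sum1_card; apply: eq_bigl => u; rewrite inE.
Qed.

(** A pair of points is counted by w exactly when it lies in a fibre of f, and
    then in only one, so w sums over the 2-subsets of the fibres. *)
Lemma pair_sum_fibers (V T : finType) (f : V -> T) (w : {set V} -> int)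
    (C : {set V}) :
  {in C &, forall u v, u != v -> w [set u; v] = (f u == f v)%:Z} ->
  pair_sum w C = (\sum_i 'C(#|[set u in C | f u == i]|, 2))%N%:Z.
Proof.
move=> wE; pose F i := [set u in C | f u == i].
have F_sub i (p : {set V}) : p \subset F i -> p \subset C.
  by move/subset_trans; apply; apply/subsetP => u; rewrite inE => /andP[].
transitivity (\sum_(p : {set V} | (p \subset C) && (#|p| == 2)%N)
                (\sum_i (p \subset F i))%N%:Z).
  apply: eq_bigr => p /andP[pC /cards2P[u [v [u_neq_v defp]]]].
  have [uC vC] : u \in C /\ v \in C.
    by split; apply: (subsetP pC); rewrite defp !inE eqxx ?orbT.
  rewrite defp wE // (bigD1 (f u)) //= big1 => [|i i_neq].
    by rewrite addn0 subUset !sub1set !inE uC vC eqxx /= (eq_sym (f v)).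
  by rewrite subUset !sub1set !inE eq_sym (negPf i_neq) andbF.
rewrite -(big_morph Posz PoszD (erefl 0)) exchange_big /=; congr Posz.
apply: eq_bigr => i _; rewrite -cards_draws -sum1_card -big_mkcondr /=.
apply: eq_bigl => p; rewrite !inE andbC.
by case: (boolP (p \subset F i)) => //= /F_sub ->.
Qed.

Lemma pair_sum_clique (V T : finType) (e : rel V) (f : V -> T)
    (w : {set V} -> int) (C : {set V}) : clique e C ->
  (forall u v, e u v -> w [set u; v] = (f u == f v)%:Z) ->
  pair_sum w C = (\sum_i 'C(#|[set u in C | f u == i]|, 2))%N%:Z.
Proof.
move=> C_clique wE; apply: pair_sum_fibers => u v uC vC u_neq_v.
by apply/wE/C_clique.
Qed.

Theorem theorem3p1 (V : finType) (e : rel V)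
  (e_sym : symmetric e) (e_irr : irreflexive e)
  (k k' : nat) (k_ge2 : (2 <= k)%N) (k'_ge2 : (2 <= k')%N)
  (C : {set V}) (C_clique : clique e C) (C_gt : (k' < #|C|)%N)
  (x : V -> 'I_(k * k') -> int) (y z : {set V} -> int)
  (xyz_feasible : feasible e x y z) :
  let t' := (#|C| %/ k')%N in
  let r' := (#|C| %% k')%N in
  k'%:Z * pair_sum z C >=
    pair_sum y C - t'%:Z * 'C(k', 2)%:Z - 'C(r', 2)%:Z.
Proof.
move=> /=; case: xyz_feasible => col [_ yE zE].
have k_gt0 : (0 < k)%N by apply: ltnW.
have k'_gt0 : (0 < k')%N by apply: ltnW.
have quo_lt (c : 'I_(k * k')) : (c %/ k < k')%N.
  by rewrite ltn_divLR // [X in (_ < X)%N]mulnC.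
pose res u : 'I_k := Ordinal (ltn_pmod (col u) k_gt0).
pose quo u : 'I_k' := Ordinal (quo_lt (col u)).
have col_eq u v : (col u == col v) = ((res u, quo u) == (res v, quo v)).
  rewrite /res /quo; apply/eqP/eqP => [-> // | [res_uv quo_uv]].
  by apply: val_inj; rewrite /= (divn_eq (col u) k) quo_uv res_uv -divn_eq.
pose N i := [set u in C | res u == i].
pose M i j := [set u in N i | quo u == j].
have sum_y : pair_sum y C = (\sum_i 'C(#|N i|, 2))%N%:Z.
  by apply: pair_sum_clique C_clique _ => u v /yE ->.
have sum_z : pair_sum z C = (\sum_i \sum_j 'C(#|M i j|, 2))%N%:Z.
  rewrite pair_big /= (pair_sum_clique (f := fun u => (res u, quo u)) C_clique).
    congr Posz; apply: eq_bigr => -[i j] _; congr 'C(#|pred_of_set _|, 2).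
    by apply/setP => u; rewrite !inE xpair_eqE andbA.
  by move=> u v /zE ->; rewrite col_eq.
have bound : (\sum_i 'C(#|N i|, 2)
    <= k' * (\sum_i \sum_j 'C(#|M i j|, 2)) + packed_pairs k' #|C|)%N.
  rewrite (card_fibers res C).
  apply: leq_trans (leq_add (leqnn _) (packed_pairs_sum _ k'_gt0)).
  rewrite big_distrr -big_split /=; apply: leq_sum => i _.
  have := bin2_sum_le (fun j => #|M i j|).
  by rewrite card_ord -(card_fibers quo).
by rewrite sum_y sum_z; move: bound; rewrite /packed_pairs; lia.
Qed.
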